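(* Let $n\ge 1$ be an integer, let $i_1,\dots,i_n$ be independent real random variables with $E(1+i_l)=1+j$ and $Var(1+i_l)=s^2$ for every $l$, where $j\in\mathbb{R}\setminus\{0,-1\}$, and let $1\le k\le n$. Let $C_k$ be the final value of the decreasing annuity-due with $k$ annual payments $n,n-1,\dots,n-k+1$. Then $$E(C_k)=(D\ddot s)_{\overline{n,k}|j},$$ $$Var(C_k)=\frac{\ell}{d^2}\Big[\frac{(n-1/j)^2(1+j)^{2k}\ddot s_{\overline{k}|\ell}}{1+\ell}-\frac{2(n-1/j)^2(1+j)^k\ddot s_{\overline{k}|r}}{1+r}+\frac{(n-1/j)^2\ddot s_{\overline{k}|f}}{1+f}+\frac{2(n-1/j)(1+j)^k(I\ddot s)_{\overline{k}|r}}{1+r}-\frac{2(n-1/j)(I\ddot s)_{\overline{k}|f}}{1+f}+\frac{(I^2\ddot s)_{\overline{k}|f}}{1+f}\Big],$$ where $\ell=(s/(1+j))^2$.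
   Context: Final value: for annual payments $c_1,c_2,\dots$ the final value is defined by $C_1=(1+i_1)c_1$ and $C_k=(1+i_k)(C_{k-1}+c_k)$ for $k\ge 2$; here $c_l=n-l+1$. For a positive integer $k$ and real $x$: $\ddot s_{\overline{k}|x}=\sum_{l=1}^k(1+x)^{k+1-l}$, $(I\ddot s)_{\overline{k}|x}=\sum_{l=1}^k l(1+x)^{k+1-l}$, $(I^2\ddot s)_{\overline{k}|x}=\sum_{l=1}^k l^2(1+x)^{k+1-l}$, and $(D\ddot s)_{\overline{n,k}|x}=\sum_{l=1}^k(n-l+1)(1+x)^{k+1-l}$. Constants: $d=j/(1+j)$, $f=2j+j^2+s^2$ (so $1+f=E[(1+i_l)^2]$), and $r$ is defined by $1+r=(1+f)/(1+j)$. *)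

(* Defs.v *)
From HB Require Import structures.
From mathcomp Require Export all_boot all_order all_algebra finmap.
From mathcomp Require Export all_classical all_reals all_analysis.

Set Implicit Arguments.
Unset Strict Implicit.
Unset Printing Implicit Defensive.

Import Order.TTheory GRing.Theory Num.Theory.
Import numFieldNormedType.Exports.

Local Open Scope classical_set_scope.
Local Open Scope ring_scope.

(* Mutual independence of the subfamily (X l), l in D: the product rule holds
   for every finite subset J of D and all Borel sets B l. *)
Definition mutually_independent d (T : measurableType d) (R : realType)
    (P : probability T R) (I : choiceType) (D : set I)
    (X : I -> {RV P >-> R}) : Prop :=
  forall (J : {fset I}) (B : I -> set R),
    [set` J] `<=` D ->
    (forall l, measurable (B l)) ->
    P (\bigcap_(l in [set` J]) (X l @^-1` B l)) =
    (\prod_(l <- J) P (X l @^-1` B l))%E.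

(* Final value after k years of an annuity-due with payments c 1, c 2, ... and
   annual rates i 1, i 2, ...; the value at k = 0 is a dummy. *)
Fixpoint final_value (R : realType) (i c : nat -> R) (k : nat) : R :=
  match k with
  | 0 => 0
  | 1 => (1 + i 1%N) * c 1%N
  | k'.+1 => (1 + i k'.+1) * (final_value i c k' + c k'.+1)
  end.

(* The actuarial accumulated values at rate x of the annuities-due over k years
   with payments 1, l, l^2 and n - l + 1 in year l. *)
Definition sdd (R : realType) (k : nat) (x : R) : R :=
  \sum_(1 <= l < k.+1) (1 + x) ^+ (k + 1 - l).

Definition Isdd (R : realType) (k : nat) (x : R) : R :=
  \sum_(1 <= l < k.+1) l%:R * (1 + x) ^+ (k + 1 - l).

Definition I2sdd (R : realType) (k : nat) (x : R) : R :=
  \sum_(1 <= l < k.+1) l%:R ^+ 2 * (1 + x) ^+ (k + 1 - l).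

Definition Dsdd (R : realType) (n k : nat) (x : R) : R :=
  \sum_(1 <= l < k.+1) (n%:R - l%:R + 1) * (1 + x) ^+ (k + 1 - l).

(* Main.v *)
(** The recursion C_(m+1) = (1 + i_(m+1)) (C_m + c_(m+1)) multiplies two
    independent square-integrable variables, since C_m is measurable for the
    sigma-algebra of i_1, ..., i_m.  With v = 1 + j, the mean mu_m = E(C_m) thus
    satisfies mu_(m+1) = v (mu_m + c_(m+1)), and
      V(C_(m+1)) = (v^2 + s^2) V(C_m) + s^2 (mu_(m+1) / v)^2,
    so that V(C_k) = l * sum_(1 <= m <= k) (1 + f)^(k-m) mu_m^2.  Inserting
    d mu_m = A v^m - A + m with A = n - 1/j and expanding the square yields the
    six terms, because (1 + f) = v^2 (1 + l) = v (1 + r). *)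
Require Import Defs.
From mathcomp Require Import ring measurable_realfun.
Set Implicit Arguments.
Unset Strict Implicit.

Import Order.TTheory GRing.Theory Num.Theory.
Import numFieldNormedType.Exports.
Local Open Scope classical_set_scope.
Local Open Scope ring_scope.

(** * Products of two independent random variables *)

Definition independent_pair d (T : measurableType d) (R : realType)
    (P : probability T R) (X Y : T -> R) : Prop :=
  forall A B, measurable A -> measurable B ->
  P (X @^-1` A `&` Y @^-1` B) = (P (X @^-1` A) * P (Y @^-1` B))%E.

Section independence.
Context d (T : measurableType d) (R : realType) (P : probability T R).

(** The finite measures [A |-> P (A & E)] and [A |-> P E * P A] agree on the pi-system [G], hence on
    the sigma-algebra it generates. *)
Lemma g_sigma_algebra_independent (G : set (set T)) (E : set T) :
    G `<=` measurable -> setI_closed G -> G setT -> measurable E ->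
    (forall A, G A -> P (A `&` E) = (P A * P E)%E) ->
  forall A, <<s G >> A -> P (A `&` E) = (P A * P E)%E.
Proof.
move=> Gm GI GT mE GE A sA.
have PE : (fine (P E))%:E = P E by rewrite fineK// fin_num_measure.
have PE0 : 0 <= fine (P E) by rewrite fine_ge0.
pose m1 : {measure set T -> \bar R} := mrestr P mE.
pose m2 : {measure set T -> \bar R} := mscale (NngNum PE0) P.
suff : m1 A = m2 A by rewrite /m1 /m2/= /mrestr /mscale/= PE muleC.
apply: (@g_sigma_algebra_measure_unique _ _ _ G Gm (fun=> setT)) sA => //.
- by apply/seteqP; split => // x _; exists 0%N.
- by move=> B GB; rewrite /m1 /m2 /= /mrestr /mscale /= PE GE// muleC.
- move=> _; rewrite /m1 /= /mrestr setTI.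
  by rewrite (le_lt_trans (probability_le1 _ mE))// ltry.
Qed.

Lemma independent_pair_comp (X Y : T -> R) (g h : R -> R) :
  measurable_fun setT g -> measurable_fun setT h ->
  independent_pair P X Y -> independent_pair P (g \o X) (h \o Y).
Proof.
move=> mg mh XY A B mA mB; apply: (XY (g @^-1` A) (h @^-1` B)).
- by rewrite -[_ @^-1` _]setTI; exact: mg.
- by rewrite -[_ @^-1` _]setTI; exact: mh.
Qed.

(** Independence is exactly agreement of the joint law with the product law on rectangles, and
    rectangles determine the product measure. *)
Lemma independent_pair_distribution (X Y : {RV P >-> R})
    (Z : {RV P >-> (R * R)%type}) (A : set (R * R)) :
  independent_pair P X Y -> Z = (fun w => (X w, Y w)) :> (_ -> _) ->
  measurable A ->
  (distribution P X \x distribution P Y)%E A = distribution P Z A.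
Proof.
move=> XY ZE mA; apply: product_measure_unique => // B C mB mC.
by rewrite -[LHS]/(P (Z @^-1` (B `*` C))) ZE -XY.
Qed.

(** By Tonelli the integral of [|z.1 * z.2|] factors into the absolute first moments of [X] and [Y],
    both finite. *)
Lemma integrable_independent_pairM (X Y : {RV P >-> R}) :
  P.-integrable setT (EFin \o X) -> P.-integrable setT (EFin \o Y) ->
  (distribution P X \x distribution P Y)%E.-integrable setT
    (fun z : R * R => (z.1 * z.2)%:E).
Proof.
move=> iX iY.
have iQX : (distribution P X).-integrable setT (@EFin R).
  by apply: integrable_pushforward => //; exact: measurable_funPT.
have iQY : (distribution P Y).-integrable setT (@EFin R).
  by apply: integrable_pushforward => //; exact: measurable_funPT.
apply/integrable12ltyP => /=.
  by apply/measurable_EFinP; exact: measurable_funM.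
have /integrableP[_ ltX] := iQX; have /integrableP[_ ltY] := iQY.
rewrite (eq_integral (fun x : R => `|x%:E| * \int[distribution P Y]_y `|y%:E|)%E); last first.
  move=> x _; rewrite -ge0_integralZl//; last exact: measurableT_comp.
  by apply: eq_integral => y _; rewrite -abseM -EFinM.
rewrite ge0_integralZr//; [|exact: measurableT_comp|exact: integral_ge0].
rewrite lte_mul_pinfty//; first exact: integral_ge0.
by rewrite ge0_fin_numE//; exact: integral_ge0.
Qed.

(** The expectation of [X * Y] is the integral of [z.1 * z.2] against the joint law; this law is the
    product law, so Fubini factors it. *)
Lemma independent_expectationM (X Y : T -> R) :
  independent_pair P X Y -> X \in Lfun P 1 -> Y \in Lfun P 1 ->
  X * Y \in Lfun P 1 /\ 'E_P[(X * Y)%R]%E = ('E_P[X] * 'E_P[Y])%E.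
Proof.
move=> XY X1 Y1.
pose X' : {RV P >-> R} := mfun_Sub (sub_Lfun_mfun X1).
pose Y' : {RV P >-> R} := mfun_Sub (sub_Lfun_mfun Y1).
have iX : P.-integrable setT (EFin \o X') by exact/Lfun1_integrable.
have iY : P.-integrable setT (EFin \o Y') by exact/Lfun1_integrable.
have mXY : measurable_fun setT (fun w => (X' w, Y' w)).
  by apply: measurable_fun_pair; exact: measurable_funPT.
pose Z : {RV P >-> (R * R)%type} := mfun_Sub (mem_set mXY : _ \in mfun).
pose f := (fun z : R * R => (z.1 * z.2)%:E).
have mf : measurable_fun setT f.
  by apply/measurable_EFinP; exact: measurable_funM.
have QZ (A : set (R * R)) : measurable A -> A `<=` setT ->
    (distribution P X' \x distribution P Y')%E A = distribution P Z A.
  by move=> mA _; exact: independent_pair_distribution.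
have iQ := integrable_independent_pairM iX iY.
have iP : P.-integrable setT (f \o Z).
  apply/integrableP; split; first exact: measurableT_comp.
  have /integrableP[_] := iQ.
  rewrite (eq_measure_integral _ QZ) ge0_integral_distribution//.
  exact: measurableT_comp.
split; first exact/Lfun1_integrable.
rewrite unlock.
have -> : (\int[P]_w ((X * Y) w)%:E = \int[P]_w (f \o Z) w)%E by [].
rewrite -integral_distribution// -(eq_measure_integral _ QZ).
rewrite -integral12_prod_meas1//=.
transitivity (\int[distribution P X']_x (x%:E * \int[distribution P Y']_y y%:E))%E.
  apply: eq_integral => x _; rewrite /fubini_F -integralZl//.
  by apply: integrable_pushforward => //; exact: measurable_funPT.
(* The inner integral is finite; writing it as a real constant lets it be pulled out of the outer
   one. *)
have EYE : (\int[distribution P Y']_y y%:E = (fine 'E_P[Y])%:E)%E.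
  by rewrite integral_distribution// fineK ?expectation_fin_num// unlock.
rewrite EYE integralZr//; last first.
  by apply: integrable_pushforward => //; exact: measurable_funPT.
by rewrite -EYE !integral_distribution.
Qed.

Lemma integrable_sqr_Lfun2 (X : T -> R) :
  measurable_fun setT X -> P.-integrable setT (fun w => (X w ^+ 2)%:E) ->
  X \in Lfun P 2%:E.
Proof.
move=> mX /integrableP[_ iX]; rewrite inE; apply/andP; split; rewrite inE//=.
rewrite /finite_norm unlock /Lnorm poweR_lty//.
apply: le_lt_trans iX; rewrite le_eqVlt; apply/orP; left; apply/eqP.
by apply: eq_integral => w _ /=; rewrite powR_mulrn// -normrX.
Qed.

(** The variance integrates [(X - m)^2] with [m] a real number by definition ([fine] of the mean),
    so its finiteness puts [X - m], and then [X], in L2 without prior integrability of [X]. *)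
Lemma variance_Lfun2 (X : T -> R) (v : R) :
  measurable_fun setT X -> 'V_P[X]%E = v%:E -> X \in Lfun P 2%:E.
Proof.
move=> mX; rewrite /variance unlock; set m := fine _ => VX.
have mXm : measurable_fun setT (X \- cst m) by exact: measurable_funB.
have Xm2 : X \- cst m \in Lfun P 2%:E.
  apply: integrable_sqr_Lfun2 => //; apply/integrableP; split.
    by apply/measurable_EFinP; exact: measurable_funX.
  under eq_integral => w _ do rewrite gee0_abs ?lee_fin ?sqr_ge0//.
  by move: VX; rewrite unlock => VX; rewrite [ltLHS]VX ltry.
rewrite (_ : X = (X \- cst m) \+ cst m); last by apply/funext => w /=; rewrite subrK.
by rewrite rpredD ?lee1n//= => _; exact: Lfun_cst.
Qed.

Lemma expectation_sqr (X : T -> R) (x v : R) : X \in Lfun P 2%:E ->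
  'E_P[X]%E = x%:E -> 'V_P[X]%E = v%:E -> 'E_P[(X ^+ 2)%R]%E = (v + x ^+ 2)%:E.
Proof.
move=> X2 EX; rewrite varianceE// EX => VX.
by rewrite EFinD -VX EFin_expe subeK.
Qed.

(** The squares are independent too, so the second moment of the product is [(v + x^2) (u + y^2)];
    subtract [(x y)^2]. *)
Lemma independent_varianceM (X Y : T -> R) (x y v u : R) :
  independent_pair P X Y -> X \in Lfun P 2%:E -> Y \in Lfun P 2%:E ->
  'E_P[X]%E = x%:E -> 'V_P[X]%E = v%:E ->
  'E_P[Y]%E = y%:E -> 'V_P[Y]%E = u%:E ->
  [/\ X * Y \in Lfun P 2%:E, 'E_P[(X * Y)%R]%E = (x * y)%:E &
    'V_P[(X * Y)%R]%E = (v * u + v * y ^+ 2 + u * x ^+ 2)%:E].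
Proof.
move=> XY X2 Y2 EX VX EY VY.
have L21 := Lfun_subset12 (fin_num_measure P _ measurableT).
have mX : measurable_fun setT X by move: X2 => /andP[/[!inE]].
have mY : measurable_fun setT Y by move: Y2 => /andP[/[!inE]].
have [XY1 EXY] := independent_expectationM XY (L21 _ X2) (L21 _ Y2).
have msqr : measurable_fun setT (fun t : R => t ^+ 2) by exact: measurable_funX.
have [SS1 ESS] := independent_expectationM (independent_pair_comp msqr msqr XY)
  (Lfun2_mul_Lfun1 X2 X2) (Lfun2_mul_Lfun1 Y2 Y2).
have XYsqr : (X * Y) ^+ 2 = ((fun t => t ^+ 2) \o X) * ((fun t => t ^+ 2) \o Y).
  by apply/funext => w; rewrite /= exprMn.
have XY2 : X * Y \in Lfun P 2%:E.
  apply: integrable_sqr_Lfun2; first exact: measurable_funM.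
  by move: SS1; rewrite -XYsqr => /Lfun1_integrable.
have EXYr : 'E_P[(X * Y)%R]%E = (x * y)%:E by rewrite EXY EX EY.
split => //; rewrite varianceE// EXYr XYsqr ESS.
rewrite (expectation_sqr X2 EX VX) (expectation_sqr Y2 EY VY).
by rewrite -EFinM -EFin_expe -EFinB; congr EFin; ring.
Qed.

End independence.

(** * Independence of one variable from the sigma-algebra of finitely many others *)

Section cylinders.
Context d (T : measurableType d) (R : realType) (P : probability T R).
Context (I : choiceType) (X : I -> {RV P >-> R}).

(** A pi-system generating the sigma-algebra of the [X l], [l] in [J], in the shape of the events of
    [mutually_independent]. *)
Definition cylinder (J : {fset I}) : set (set T) :=
  [set A | exists2 B : I -> set R, (forall l, measurable (B l)) &
    A = \bigcap_(l in [set` J]) (X l @^-1` B l)].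

Lemma cylinder_measurable J : cylinder J `<=` measurable.
Proof.
move=> _ [B mB ->]; apply: fin_bigcap_measurable; first exact: finite_fset.
by move=> l _; exact: measurable_funPTI.
Qed.

Lemma cylinder_setI_closed J : setI_closed (cylinder J).
Proof.
move=> _ _ [B mB ->] [B' mB' ->].
exists (fun l => B l `&` B' l); first by move=> l; exact: measurableI.
by rewrite -bigcapI.
Qed.

Lemma cylinderT J : cylinder J setT.
Proof.
by exists (fun=> setT) => //; apply/seteqP; split.
Qed.

Lemma measurable_cylinder (J : {fset I}) l : l \in J ->
  measurable_fun setT (X l : g_sigma_algebraType (cylinder J) -> R).
Proof.
move=> lJ _ B mB; rewrite setTI; apply: sub_sigma_algebra.
exists (fun k => if k == l then B else setT); first by move=> k; case: ifP.
apply/seteqP; split => [w Bw k _|w /(_ l lJ)] /=; last by rewrite eqxx.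
by case: eqP => [->|].
Qed.

(** It suffices to test events of [Z] that are cylinders over [J]; there the claim follows by
    comparing the product rules for [J] and for [J] with [l] added. *)
Lemma independent_cylinder (D : set I) (J : {fset I}) l (Z : T -> R) :
  mutually_independent D X -> [set` J] `<=` D -> D l -> l \notin J ->
  measurable_fun setT (Z : g_sigma_algebraType (cylinder J) -> R) ->
  independent_pair P (X l) Z.
Proof.
move=> indep JD Dl lJ mZ B A mB mA; rewrite setIC muleC.
have mXB : measurable (X l @^-1` B) by exact: measurable_funPTI.
apply: (g_sigma_algebra_independent (@cylinder_measurable J)
  (@cylinder_setI_closed J) (@cylinderT J) mXB); last first.
  by have := mZ measurableT A mA; rewrite setTI.
move=> _ [C mC ->].
(* Since [l] is not in [J], changing [C] at [l] leaves the cylinder over [J] intact. *)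
pose C' k := if k == l then B else C k.
have mC' k : measurable (C' k) by rewrite /C'; case: ifP.
have lJD : [set` (l |` J)%fset] `<=` D.
  by move=> k /=; rewrite in_fset1U => /orP[/eqP -> //|]; exact: JD.
have C'J k : k \in J -> C' k = C k.
  by rewrite /C'; case: eqP => // -> lJ'; rewrite lJ' in lJ.
have := indep _ C' lJD mC'; rewrite big_fsetU1//= set_fsetU1 bigcap_setU1.
rewrite {1 3}/C' eqxx setIC muleC.
have -> : \bigcap_(k in [set` J]) X k @^-1` C' k =
          \bigcap_(k in [set` J]) X k @^-1` C k.
  by apply: eq_bigcapr => k /= /C'J ->.
rewrite (indep J C JD mC) => ->; congr (_ * _)%E.
by rewrite !big_seq; apply: eq_bigr => k /C'J ->.
Qed.

End cylinders.

(** The dummy value 0 at [m = 0] makes the recursion uniform, first year included. *)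
Lemma final_valueS (R : realType) (i c : nat -> R) (m : nat) :
  final_value i c m.+1 = (1 + i m.+1) * (final_value i c m + c m.+1).
Proof. by case: m => //=; rewrite add0r. Qed.

(** * Mean and variance of the final value for arbitrary payments *)

Section final_value_moments.
Context d (T : measurableType d) (R : realType) (P : probability T R).
Variables (i : nat -> {RV P >-> R}) (c : nat -> R) (j s : R) (n : nat).
Hypothesis indep : mutually_independent [set l : nat | (1 <= l <= n)%N] i.
Hypothesis Ei : forall l : nat, (1 <= l <= n)%N ->
  ('E_P[fun w => (1 + i l w)%R] = (1 + j)%:E)%E.
Hypothesis Vi : forall l : nat, (1 <= l <= n)%N ->
  ('V_P[fun w => (1 + i l w)%R] = (s ^+ 2)%:E)%E.

Let C m w := final_value (fun l => i l w) c m.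
Let mu m := final_value (fun=> j) c m.

Let past m : {fset nat} := [fset l in iota 1 m]%fset.

Lemma in_past m l : (l \in past m) = (1 <= l <= m)%N.
Proof. by rewrite /past inE /= mem_iota add1n ltnS. Qed.

(** Only the rates of years 1 to [m] enter [C m]; keeping [p] fixed lets the induction stay in one
    sigma-algebra. *)
Lemma measurable_final_value p m : (m <= p)%N ->
  measurable_fun setT (C m : g_sigma_algebraType (cylinder i (past p)) -> R).
Proof.
elim: m => [|m IHm] mp; first exact: measurable_cst.
rewrite (_ : C m.+1 = fun w => (1 + i m.+1 w) * (C m w + c m.+1)); last first.
  by apply/funext => w; exact: final_valueS.
apply: measurable_funM; apply: measurable_funD => //.
- by apply: measurable_cylinder; rewrite in_past.
- exact: IHm (ltnW mp).
Qed.

(** Induction by the product formulas for [1 + i m.+1] and [C m + c m.+1]; membership in L2 is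
    carried along because they require it. The term of index [l] is the variance arising in year
    [l.+1]. *)
Lemma final_value_moments m : (m <= n)%N ->
  [/\ C m \in Lfun P 2%:E, 'E_P[C m]%E = (mu m)%:E &
   'V_P[C m]%E = (s ^+ 2 * \sum_(l < m)
      ((1 + j) ^+ 2 + s ^+ 2) ^+ (m - l.+1) * (mu l + c l.+1) ^+ 2)%:E].
Proof.
elim: m => [|m IHm] mn.
  split; first exact: Lfun_cst; first exact: expectation_cst.
  by rewrite big_ord0 mulr0; exact: variance_cst.
have [C2 EC VC] := IHm (ltnW mn).
have mn' : (1 <= m.+1 <= n)%N by [].
pose X := fun w => 1 + i m.+1 w; pose W := C m \+ cst (c m.+1).
have mX : measurable_fun setT X by exact: measurable_funD.
have X2 : X \in Lfun P 2%:E := variance_Lfun2 mX (Vi mn').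
have L21 := Lfun_subset12 (fin_num_measure P _ measurableT).
have W2 : W \in Lfun P 2%:E by rewrite rpredD ?lee1n//= => _; exact: Lfun_cst.
have EW : 'E_P[W]%E = (mu m + c m.+1)%:E.
  by rewrite expectationD ?Lfun_cst// ?L21// EC expectation_cst.
have VW := VC; rewrite -(varianceD_cst_r (c m.+1) C2) in VW.
have XW : independent_pair P X W.
  apply: (@independent_pair_comp _ _ _ _ (i m.+1) (C m)
    (fun x => 1 + x) (fun x => x + c m.+1)).
  - exact: measurable_funD.
  - exact: measurable_funD.
  (* [C m] depends on years 1 to [m] only, and year [m.+1] lies outside them. *)
  apply: (independent_cylinder (J := past m) indep) => //.
  - by move=> l /=; rewrite in_past => /andP[-> /leq_trans]; apply; exact: ltnW.
  - by rewrite in_past ltnn.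
  - exact: measurable_final_value.
have CS : C m.+1 = X * W by apply/funext => w; exact: final_valueS.
have [CS2 ECS VCS] := independent_varianceM XW X2 W2 (Ei mn') (Vi mn') EW VW.
rewrite CS; split => //; first by rewrite ECS /mu final_valueS.
(* The last term, of exponent 0, is the new contribution; every earlier one gains a factor
   [(1 + j)^2 + s^2]. *)
rewrite VCS; congr EFin; rewrite big_ord_recr/= subnn expr0 mul1r.
have -> : \sum_(l < m) ((1 + j) ^+ 2 + s ^+ 2) ^+ (m.+1 - l.+1) *
      (mu l + c l.+1) ^+ 2 = ((1 + j) ^+ 2 + s ^+ 2) *
    \sum_(l < m) ((1 + j) ^+ 2 + s ^+ 2) ^+ (m - l.+1) * (mu l + c l.+1) ^+ 2.
  rewrite mulr_sumr; apply: eq_bigr => l _.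
  by rewrite subSn// exprS mulrA.
ring.
Qed.

End final_value_moments.

(** * Closed forms and rescaling of the actuarial sums *)

Section actuarial_sums.
Variable R : realType.
Implicit Types (n k : nat) (j : R).

(** One more year multiplies each old term by [1 + j] and appends the new payment with one year of
    interest. *)
Lemma Dsdd_final_value n k j :
  Dsdd n k j = final_value (fun=> j) (fun l => n%:R - l%:R + 1) k.
Proof.
elim: k => [|k IHk]; first by rewrite /Dsdd big_geq.
rewrite final_valueS -IHk {1}/Dsdd big_nat_recr//= addn1 subSnn expr1.
rewrite [RHS]mulrDr mulr_sumr; congr (_ + _); last by rewrite mulrC.
apply: eq_big_nat => l /andP[_ lk].
by rewrite !addn1 (subSn (ltnW lk)) exprS mulrCA.
Qed.

Lemma final_value_closed_form n k j : j != 0 -> 1 + j != 0 ->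
  final_value (fun=> j) (fun l => n%:R - l%:R + 1) k =
  ((n%:R - 1 / j) * (1 + j) ^+ k - (n%:R - 1 / j) + k%:R) / (j / (1 + j)).
Proof.
move=> j0 v0; elim: k => [|k IHk]; first by rewrite /= expr0; field; rewrite j0 v0.
by rewrite final_valueS IHk exprS -natr1; field; rewrite j0 v0.
Qed.

(** Termwise, [w^k x^(k+1-l) / x = w^l (w x)^(k-l)]. This brings the sums at the rates [ell], [r]
    and [f] to the common ratio [g = 1 + f]. *)
Lemma accumulation_rescale (w x g : R) (t : nat -> R) k : x != 0 -> w * x = g ->
  w ^+ k * (\sum_(1 <= l < k.+1) t l * x ^+ (k + 1 - l)) / x =
  \sum_(1 <= l < k.+1) t l * (w ^+ l * g ^+ (k - l)).
Proof.
move=> x0 <-; rewrite mulr_sumr mulr_suml; apply: eq_big_nat => l /andP[_ lk].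
rewrite addn1 subSn// exprS exprMn -{1}(subnK (lk : l <= k)%N) exprD.
by field.
Qed.

End actuarial_sums.

(** * The decreasing annuity *)

Theorem corollary3p4 (dT : measure_display) (T : measurableType dT)
    (R : realType) (P : probability T R)
    (n : nat) (hn : (1 <= n)%N)
    (i : nat -> {RV P >-> R})
    (j s : R) (hj0 : j != 0) (hj1 : j != -1)
    (hindep : mutually_independent [set l : nat | (1 <= l <= n)%N] i)
    (hE : forall l : nat, (1 <= l <= n)%N ->
       ('E_P[fun w => (1 + i l w)%R] = (1 + j)%:E)%E)
    (hV : forall l : nat, (1 <= l <= n)%N ->
       ('V_P[fun w => (1 + i l w)%R] = (s ^+ 2)%:E)%E)
    (k : nat) (hk1 : (1 <= k)%N) (hkn : (k <= n)%N)
    (d f r ell : R)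
    (hd : d = j / (1 + j))
    (hf : f = 2 * j + j ^+ 2 + s ^+ 2)
    (hr : 1 + r = (1 + f) / (1 + j))
    (hell : ell = (s / (1 + j)) ^+ 2)
    (C : T -> R)
    (hC : C = fun w =>
       final_value (fun l => i l w) (fun l => n%:R - l%:R + 1) k) :
  ('E_P[C] = (Dsdd n k j)%:E)%E /\
  ('V_P[C] =
    (ell / d ^+ 2 *
     ((n%:R - 1 / j) ^+ 2 * (1 + j) ^+ (2 * k) * sdd k ell / (1 + ell)
      - 2 * (n%:R - 1 / j) ^+ 2 * (1 + j) ^+ k * sdd k r / (1 + r)
      + (n%:R - 1 / j) ^+ 2 * sdd k f / (1 + f)
      + 2 * (n%:R - 1 / j) * (1 + j) ^+ k * Isdd k r / (1 + r)
      - 2 * (n%:R - 1 / j) * Isdd k f / (1 + f)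
      + I2sdd k f / (1 + f)))%:E)%E.
Proof.
have v0 : 1 + j != 0 by rewrite addrC -[1]opprK subr_eq0.
have v2 : 0 < (1 + j) ^+ 2 by rewrite exprn_even_gt0.
have fE : 1 + f = (1 + j) ^+ 2 + s ^+ 2 by rewrite hf; ring.
have g0 : 1 + f != 0 by rewrite fE gt_eqF// ltr_wpDr// sqr_ge0.
have r0 : 1 + r != 0 by rewrite hr mulf_neq0// invr_neq0.
have ellE : (1 + j) ^+ 2 * (1 + ell) = 1 + f by rewrite hell fE; field.
have ell0 : 1 + ell != 0.
  by apply: contra_neq g0 => e0; rewrite -ellE e0 mulr0.
have rE : (1 + j) * (1 + r) = 1 + f by rewrite hr mulrC divfK.
rewrite hC.
have [_ -> ->] := final_value_moments (fun l => n%:R - l%:R + 1) hindep hE hV hkn.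
split; first by rewrite Dsdd_final_value.
congr EFin; set A := n%:R - 1 / j.
(* All six terms take this form, with [w] equal to [(1 + j)^2], [1 + j] or 1 for the rates [ell],
   [r] and [f]. *)
pose S (t : nat -> R) w := \sum_(1 <= l < k.+1) t l * (w ^+ l * (1 + f) ^+ (k - l)).
have one (x : R) : sdd k x = \sum_(1 <= l < k.+1) 1 * (1 + x) ^+ (k + 1 - l).
  by rewrite /sdd; apply: eq_bigr => l _; rewrite mul1r.
have Sell : (1 + j) ^+ (2 * k) * sdd k ell / (1 + ell) = S (fun=> 1) ((1 + j) ^+ 2).
  by rewrite one exprM; exact: accumulation_rescale.
have Sr : (1 + j) ^+ k * sdd k r / (1 + r) = S (fun=> 1) (1 + j).
  by rewrite one; exact: accumulation_rescale.
have SIr : (1 + j) ^+ k * Isdd k r / (1 + r) = S (fun l => l%:R) (1 + j).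
  exact: accumulation_rescale.
have f1 t : (\sum_(1 <= l < k.+1) t l * (1 + f) ^+ (k + 1 - l)) / (1 + f) = S t 1.
  by have := accumulation_rescale t k g0 (mul1r _); rewrite expr1n mul1r.
have Sf : sdd k f / (1 + f) = S (fun=> 1) 1 by rewrite one f1.
have SIf : Isdd k f / (1 + f) = S (fun l => l%:R) 1 by exact: f1.
have SI2f : I2sdd k f / (1 + f) = S (fun l => l%:R ^+ 2) 1 by exact: f1.
transitivity (ell / d ^+ 2 * (A ^+ 2 * S (fun=> 1) ((1 + j) ^+ 2)
  - 2 * A ^+ 2 * S (fun=> 1) (1 + j) + A ^+ 2 * S (fun=> 1) 1
  + 2 * A * S (fun l => l%:R) (1 + j) - 2 * A * S (fun l => l%:R) 1
  + S (fun l => l%:R ^+ 2) 1)); last first.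
  by rewrite -Sell -Sr -SIr -Sf -SIf -SI2f !mulrA.
(* Merged into one sum and shifted to start at 0, the bracket has summand [(1 + f)^(k - l.+1)] times
   the expanded square of [A (1 + j)^(l.+1) - A + l.+1]. *)
rewrite /S -!mulNr !mulr_sumr -!big_split/= mulr_sumr big_add1/= big_mkord.
apply: eq_bigr => l _; rewrite fE.
(* Read backwards, the recursion gives the mean plus the next payment as the next mean divided by
   [1 + j]. *)
have mu_step := final_valueS (fun=> j) (fun l => n%:R - l%:R + 1) l.
rewrite final_value_closed_form// -hd -/A in mu_step.
have -> : final_value (fun=> j) (fun l => n%:R - l%:R + 1) l + (n%:R - l.+1%:R + 1) =
    (A * (1 + j) ^+ l.+1 - A + l.+1%:R) / d / (1 + j).
  by rewrite mu_step mulrC mulKf.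
have d0 : d != 0 by rewrite hd mulf_neq0// invr_neq0.
rewrite hell !expr1n.
(* With [(1 + j)^(l.+1)] as a single atom, the square expands by [field]. *)
have -> : ((1 + j) ^+ 2) ^+ l.+1 = ((1 + j) ^+ l.+1) ^+ 2.
  by rewrite -!exprM mulnC.
by field; rewrite d0 v0.
Qed.
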